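(* Let $K$ be a field, $n\ge 1$ and $q\ge 2$ integers, and let $\mathcal{A}$ be a subalgebra of $\mathrm{M}_n(K)$. Then $\mathcal{A}$ is a maximal D$_q$ subalgebra of $\mathrm{M}_n(K)$ if and only if $\mathcal{A}$ is conjugated with a D$_q$ subalgebra of $\mathrm{M}_n(K)$ of some type $(n_1,n_2,\ldots,n_q)$ with max-comm db's.
   Context: All algebras are associative and unital over the field $K$; a subalgebra of $\mathrm{M}_n(K)$ is a (unital) $K$-subalgebra. Subalgebras $\mathcal{A},\mathcal{B}$ of $\mathrm{M}_n(K)$ are conjugated if $\mathcal{B}=X^{-1}\mathcal{A}X$ for some invertible $X\in\mathrm{M}_n(K)$. $[x,y]=xy-yx$. An algebra is D$_q$ if it satisfies the identity $[x_1,y_1][x_2,y_2]\cdots[x_q,y_q]=0$. Convention: whenever a D$_q$ subalgebra of $\mathrm{M}_n(K)$ is considered, it is assumed that $q\ge 2$ and that it is not D$_{q-1}$. A maximal D$_q$ subalgebra of $\mathrm{M}_n(K)$ is a D$_q$ subalgebra that is maximal with respect to inclusion among D$_q$ subalgebras of $\mathrm{M}_n(K)$. For positive integers $n_1,\ldots,n_q$ ($q\ge 2$) with $n_1+\cdots+n_q=n$, view matrices in $\mathrm{M}_n(K)$ as $q\times q$ block matrices whose $(i,j)$ block has size $n_i\times n_j$. A subalgebra $\mathcal{A}$ of $\mathrm{M}_n(K)$ is of type $(n_1,\ldots,n_q)$ if there are subalgebras $\mathcal{A}_{ii}$ of $\mathrm{M}_{n_i}(K)$, $i=1,\ldots,q$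 (its diagonal blocks), such that $\mathcal{A}$ consists of exactly all block matrices whose $(i,i)$ block lies in $\mathcal{A}_{ii}$ (independently for each $i$), whose $(i,j)$ block is an arbitrary element of $\mathrm{M}_{n_i\times n_j}(K)$ for $i<j$, and whose $(i,j)$ block is zero for $i>j$. It is a D$_q$ subalgebra of $\mathrm{M}_n(K)$ of type $(n_1,\ldots,n_q)$ with max-comm db's if, moreover, every $\mathcal{A}_{ii}$ is a maximal commutative subalgebra of $\mathrm{M}_{n_i}(K)$. *)

(* Defs.v *)
From mathcomp Require Import all_boot all_order all_algebra.

Set Implicit Arguments.
Unset Strict Implicit.
Unset Printing Implicit Defensive.

Import GRing.Theory.
Local Open Scope ring_scope.

Section Subalgebras.

Variables (K : fieldType) (n : nat).
Implicit Types (A B : {vspace 'M[K]_n}) (P : {vspace 'M[K]_n} -> Prop).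

(* Unital subalgebras, as subspaces: the type {aspace _} is not used because it
   only requires an internal unit, possibly different from 1%:M, and because
   it requires matrix sizes that are syntactically successors (as does
   GRing.subalg_closed). *)
Definition is_subalgebra A : Prop :=
  1%:M \in A /\ {in A &, forall M N, M *m N \in A}.

Definition is_maximal_subalgebra P A : Prop :=
  [/\ is_subalgebra A, P A &
      forall B, is_subalgebra B -> P B -> (A <= B)%VS -> B = A].

Definition is_commutative A : Prop := {in A &, forall M N, M *m N = N *m M}.

Definition mxcomm (x y : 'M[K]_n) : 'M[K]_n := x *m y - y *m x.

Definition satisfies_D (q : nat) A : Prop :=
  forall x y : 'I_q -> 'M[K]_n,
    (forall i, x i \in A) -> (forall i, y i \in A) ->
    \prod_(i < q) mxcomm (x i) (y i) = 0.

(* "D_q" is understood as "D_q but not D_(q-1)"; this is meant for q >= 2. *)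
Definition is_D (q : nat) A : Prop := satisfies_D q A /\ ~ satisfies_D q.-1 A.

Definition maximal_commutative A : Prop :=
  is_maximal_subalgebra is_commutative A.

Definition maximal_D (q : nat) A : Prop := is_maximal_subalgebra (is_D q) A.

Definition conjugated A B : Prop :=
  exists2 X : 'M[K]_n, X \in unitmx &
    forall M, M \in B <-> exists2 N, N \in A & M = invmx X *m N *m X.

End Subalgebras.

Section BlockTriangular.

Variables (K : fieldType) (n q : nat) (p : 'I_q -> nat).

(* M is cut into blocks of sizes p i x p j after transporting it along
   the equation n = \sum_i p i. *)
Definition mxblk (en : n = (\sum_i p i)%N) (M : 'M[K]_n) (i j : 'I_q) :
  'M[K]_(p i, p j) := submxblock (castmx (en, en) M) i j.

Definition of_type_with_diagonal_blocks (en : n = (\sum_i p i)%N)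
    (A : {vspace 'M[K]_n}) (D : forall i, {vspace 'M[K]_(p i)}) : Prop :=
  [/\ forall i, (0 < p i)%N,
      forall i, is_subalgebra (D i) &
      forall M : 'M[K]_n, M \in A <->
        (forall i, mxblk en M i i \in D i) /\
        (forall i j : 'I_q, (j < i)%N -> mxblk en M i j = 0)].

Definition of_type_with_max_comm_dbs (A : {vspace 'M[K]_n}) : Prop :=
  is_subalgebra A /\
  exists (en : n = (\sum_i p i)%N) (D : forall i, {vspace 'M[K]_(p i)}),
    of_type_with_diagonal_blocks en A D /\
    forall i, maximal_commutative (D i).

End BlockTriangular.

(* Main.v *)
(* Rows are acted on from the right.  For a subalgebra A, let ann m be the space
   of rows killed by every product of m commutators of A.  The identity
   a [x, y] = [a x, y] - [a, y] x makes ann m stable under A, and the D_q and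
   not D_(q-1) conditions say that 0 = ann 0 < ann 1 < ... < ann q = K^n, with
   A acting commutatively on each quotient.  In a basis adapted to this flag A
   is block upper triangular with commutative diagonal blocks; enlarging these
   to maximal commutative ones gives a D_q algebra containing A, which equals A
   if A is maximal.
   Conversely let C be a D_q algebra containing an algebra B of type
   (n_1, ..., n_q) with max-comm diagonal blocks.  The strictly upper blocks of
   B are commutators, which forces the flag of C to be the standard one; so C is
   block triangular with commutative diagonal blocks, and by maximality these
   are the diagonal blocks of B. *)
Require Import Defs.
From mathcomp Require Import all_boot all_order all_algebra.
From Stdlib Require Import Classical.

Set Implicit Arguments.
Unset Strict Implicit.
Unset Printing Implicit Defensive.

Import GRing.Theory.
Local Open Scope ring_scope.

(** * The chain of annihilators of products of commutators *)

Section Annihilators.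

Variables (K : fieldType) (n : nat) (A : {vspace 'M[K]_n}).
Implicit Types (x y : 'M[K]_n) (m k : nat).

(* The intersection runs over a basis of A; [ann_prod] is the intrinsic form. *)
Fixpoint ann m : 'M[K]_n :=
  if m is m'.+1 then
    (\bigcap_(i < \dim A) \bigcap_(j < \dim A)
      kermx (mxcomm (vbasis A)`_i (vbasis A)`_j *m cokermx (ann m')))%MS
  else 0.

Lemma mxcomm_suml I (r : seq I) (F : I -> 'M[K]_n) y :
  mxcomm (\sum_(i <- r) F i) y = \sum_(i <- r) mxcomm (F i) y.
Proof. by rewrite /mxcomm mulmx_suml mulmx_sumr -sumrB. Qed.

Lemma mxcommC x y : mxcomm x y = - mxcomm y x.
Proof. by rewrite /mxcomm opprB. Qed.

Lemma mxcommZl a x y : mxcomm (a *: x) y = a *: mxcomm x y.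
Proof. by rewrite /mxcomm -scalemxAl -scalemxAr scalerBr. Qed.

(** By bilinearity of [mxcomm], testing on a basis suffices. Only linearity in the first argument is
    proved; antisymmetry carries it over to the second. *)
Lemma sub_annS m k (v : 'M[K]_(k, n)) :
  (v <= ann m.+1)%MS <->
  {in A &, forall x y, (v *m mxcomm x y <= ann m)%MS}.
Proof.
have memA i : (i < \dim A)%N -> (vbasis A)`_i \in A.
  by move=> ltiA; rewrite vbasis_mem // mem_nth ?size_tuple.
split=> [/sub_bigcapmxP vP x y Ax Ay | vP].
- have step z :
      (forall i : 'I_(\dim A), (v *m mxcomm (vbasis A)`_i z <= ann m)%MS) ->
      forall x, x \in A -> (v *m mxcomm x z <= ann m)%MS.
    move=> vz {}x {}Ax; rewrite (coord_vbasis Ax) mxcomm_suml mulmx_sumr.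
    by apply: summx_sub => i _; rewrite mxcommZl -scalemxAr scalemx_sub.
  apply: (step y) => // i; rewrite mxcommC mulmxN eqmx_opp.
  apply: step Ay => j.
  rewrite mxcommC mulmxN eqmx_opp submxE -mulmxA -sub_kermx.
  by have /sub_bigcapmxP := vP i isT; apply.
- apply/sub_bigcapmxP => i _; apply/sub_bigcapmxP => j _.
  by rewrite sub_kermx mulmxA -submxE vP ?memA.
Qed.

Lemma ann_prod m k (v : 'M[K]_(k, n)) :
  (v <= ann m)%MS <->
  forall x y : 'I_m -> 'M[K]_n,
    (forall i, x i \in A) -> (forall i, y i \in A) ->
    v *m \prod_(i < m) mxcomm (x i) (y i) = 0.
Proof.
elim: m k v => [|m IHm] k v.
  rewrite submx0; split=> [/eqP-> x y _ _ | v0]; first by rewrite mul0mx.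
  have := v0 (fun=> 0) (fun=> 0) (fun=> mem0v A) (fun=> mem0v A).
  by rewrite big_ord0 mulmx1 => ->.
rewrite sub_annS; split=> [vP x y Ax Ay | vP x y Ax Ay].
  rewrite big_ord_recl -mulmxE mulmxA.
  by move: (vP _ _ (Ax ord0) (Ay ord0)) => /IHm; apply=> i.
apply/IHm => xs ys Axs Ays.
pose cons z (zs : 'I_m -> 'M[K]_n) (i : 'I_m.+1) :=
  if unlift ord0 i is Some j then zs j else z.
have := vP (cons x xs) (cons y ys).
rewrite big_ord_recl -mulmxE mulmxA /cons unlift_none.
under eq_bigr => i _ do rewrite liftK.
by apply=> i; case: unliftP.
Qed.

Lemma satisfies_DE m : satisfies_D m A <-> (1%:M <= ann m)%MS.
Proof.
rewrite ann_prod; split=> DA x y Ax Ay; first by rewrite mul1mx DA.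
by rewrite -[LHS]mul1mx DA.
Qed.

Lemma ann_sub m m' : (m <= m')%N -> (ann m <= ann m')%MS.
Proof.
have annS p : (ann p <= ann p.+1)%MS.
  elim: p => [|p IHp]; first exact: sub0mx.
  apply/sub_annS => x y Ax Ay; apply: submx_trans IHp.
  by apply: (proj1 (sub_annS _ _)).
move/subnK <-; elim: (m' - m)%N => // p IHp; exact: submx_trans IHp (annS _).
Qed.

(** Each term is computed monotonically from the previous one, so a chain that stalls once grows no
    further. This turns the failure of D_(q-1) into strict inclusions. *)
Lemma ann_const m m' : (ann m.+1 <= ann m)%MS -> (ann m' <= ann m)%MS.
Proof.
move=> stat; elim: m' => [|m' IHm]; first exact: sub0mx.
apply: submx_trans stat; apply/sub_annS => x y Ax Ay.
by apply: submx_trans IHm; apply: (proj1 (sub_annS _ _)).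
Qed.

Hypothesis hA : is_subalgebra A.

Lemma ann_stable m k (v : 'M[K]_(k, n)) a :
  a \in A -> (v <= ann m)%MS -> (v *m a <= ann m)%MS.
Proof.
have [_ AM] := hA.
elim: m k v a => [|m IHm] k v a Aa; first by rewrite !submx0 => /eqP->; rewrite mul0mx.
move/sub_annS=> vP; apply/sub_annS => x y Ax Ay.
(* The first term lies in [ann m] since [a *m x] is in [A]; the second by the induction hypothesis
   for the rows [v *m mxcomm a y]. *)
have -> : v *m a *m mxcomm x y = v *m mxcomm (a *m x) y - v *m mxcomm a y *m x.
  rewrite /mxcomm -!mulmxA -mulmxBr; congr (_ *m _).
  by rewrite mulmxBr mulmxBl !mulmxA opprB addrA subrK.
apply: addmx_sub; first by apply: vP => //; apply: AM.
by rewrite eqmx_opp; apply: IHm => //; apply: vP.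
Qed.

End Annihilators.

(** * Block calculus, and algebras containing the strictly upper blocks *)

Section Blocks.

Variables (K : fieldType) (q : nat).
Implicit Types (n : nat) (p : 'I_q -> nat).

(** Block rows and block columns of the identity. They confine the casts along [en] to a few lemmas:
    afterwards only their orthogonality relations and the resolution of the identity are used. *)
Definition brow n p (en : n = (\sum_i p i)%N) i : 'M[K]_(p i, n) :=
  castmx (erefl, esym en) (submxcol 1%:M i).

Definition bcol n p (en : n = (\sum_i p i)%N) j : 'M[K]_(n, p j) :=
  castmx (esym en, erefl) (submxrow 1%:M j).

Lemma mxblkE n p (en : n = (\sum_i p i)%N) (M : 'M[K]_n) i j :
  mxblk en M i j = brow en i *m M *m bcol en j.
Proof.
subst n; rewrite /mxblk /brow /bcol !castmx_id submxcol_mul mul1mx.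
by rewrite mul_submxrow mulmx1 -submxblockEv.
Qed.

Lemma brow_bcol n p (en : n = (\sum_i p i)%N) i : brow en i *m bcol en i = 1%:M.
Proof.
have := mxblkE en 1%:M i i; rewrite mulmx1 => <-.
by subst n; rewrite /mxblk castmx_id -mxdiagZ submxblock_diag.
Qed.

Lemma brow_bcol0 n p (en : n = (\sum_i p i)%N) i j :
  i != j -> brow en i *m bcol en j = 0.
Proof.
move=> /negbTE neq_ij; have := mxblkE en 1%:M i j; rewrite mulmx1 => <-.
by subst n; rewrite /mxblk castmx_id -mxdiagZ /mxdiag mxblockK neq_ij.
Qed.

Lemma sum_bcol_brow n p (en : n = (\sum_i p i)%N) :
  \sum_i bcol en i *m brow en i = 1%:M.
Proof.
subst n; rewrite -[1%:M]mulmx1 -{1}[1%:M]submxrowK -{2}[1%:M]submxcolK.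
by rewrite mul_mxrow_mxcol; apply: eq_bigr => i _; rewrite /bcol /brow !castmx_id.
Qed.

Section Fixed.

Variables (n : nat) (p : 'I_q -> nat) (en : n = (\sum_i p i)%N).
Implicit Types (M N x y : 'M[K]_n) (A B C : {vspace 'M[K]_n}).

Local Notation blk := (@mxblk K n q p en).
Local Notation brow := (brow en).
Local Notation bcol := (bcol en).

Definition btrig M := forall i j : 'I_q, (j < i)%N -> blk M i j = 0.

Lemma mxblk1 i : blk 1%:M i i = 1%:M.
Proof. by rewrite mxblkE mulmx1 brow_bcol. Qed.

Lemma mxblkM M N i j : blk (M *m N) i j = \sum_k blk M i k *m blk N k j.
Proof.
rewrite !mxblkE -[M in LHS]mulmx1 -(sum_bcol_brow en) mulmx_sumr mulmx_suml.
rewrite mulmx_sumr mulmx_suml; apply: eq_bigr => k _.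
by rewrite !mxblkE !mulmxA.
Qed.

Lemma mxblkB M N i j : blk (M - N) i j = blk M i j - blk N i j.
Proof. by rewrite !mxblkE mulmxBr mulmxBl. Qed.

Lemma btrig1 : btrig 1%:M.
Proof.
move=> i j ltji; rewrite mxblkE mulmx1 brow_bcol0 //.
by apply: contraTneq ltji => ->; rewrite ltnn.
Qed.

Lemma btrigM M N : btrig M -> btrig N -> btrig (M *m N).
Proof.
move=> tM tN i j ltji; rewrite mxblkM big1 // => k _.
have [ltki | leik] := ltnP k i; first by rewrite tM ?mul0mx.
by rewrite tN ?mulmx0 // (leq_trans ltji).
Qed.

Lemma btrigB M N : btrig M -> btrig N -> btrig (M - N).
Proof. by move=> tM tN i j ltji; rewrite mxblkB tM ?tN ?subrr. Qed.

Lemma mxblkM_diag M N i :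
  btrig M -> btrig N -> blk (M *m N) i i = blk M i i *m blk N i i.
Proof.
move=> tM tN; rewrite mxblkM (bigD1 i) //= big1 ?addr0 // => k neqki.
have [ltki | ltik | eqki] := ltngtP k i; first by rewrite tM ?mul0mx.
  by rewrite tN ?mulmx0.
by case/eqP: neqki; apply: val_inj.
Qed.

(** Each commutator pushes the support of a row at least one block to the right, so rows supported
    on the last [m] blocks lie in [ann A m]. For [m = q] the support condition is empty. *)
Lemma strict_satisfies_D A :
  {in A &, forall x y, forall i j : 'I_q, (j <= i)%N -> blk (mxcomm x y) i j = 0} ->
  satisfies_D q A.
Proof.
move=> strict; apply/satisfies_DE.
suff kills m k (v : 'M[K]_(k, n)) :
    (forall j : 'I_q, (j + m < q)%N -> v *m bcol j = 0) -> (v <= ann A m)%MS.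
  by apply: kills => j; rewrite ltnNge leq_addl.
elim: m k v => [|m IHm] k v vP.
  rewrite submx0 -[v]mulmx1 -(sum_bcol_brow en) mulmx_sumr big1 // => j _.
  by rewrite mulmxA vP ?mul0mx ?addn0.
apply/sub_annS => x y Ax Ay; apply: IHm => j ltjq.
rewrite -[v]mulmx1 -(sum_bcol_brow en) mulmx_sumr !mulmx_suml big1 // => i _.
have [ltiq | leqi] := ltnP (i + m.+1) q.
  by rewrite mulmxA vP ?mul0mx.
rewrite -!mulmxA (mulmxA (brow i)) -mxblkE strict ?mulmx0 //.
by have := leq_trans ltjq leqi; rewrite addnS ltnS leq_add2r.
Qed.

Section UpperBlocks.

Hypothesis p_gt0 : forall i, (0 < p i)%N.
Variable C : {vspace 'M[K]_n}.
Hypothesis idemC : forall i, bcol i *m brow i \in C.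
Hypothesis upperC : forall (i j : 'I_q) (Z : 'M_(p i, p j)),
  (i < j)%N -> bcol i *m Z *m brow j \in C.

(** The block idempotent of index [i] fixes such a matrix from the left and kills it from the
    right. *)
Lemma upper_mxcomm (i j : 'I_q) (Z : 'M_(p i, p j)) : (i < j)%N ->
  mxcomm (bcol i *m brow i) (bcol i *m Z *m brow j) = bcol i *m Z *m brow j.
Proof.
move=> ltij; rewrite /mxcomm.
rewrite -!mulmxA (mulmxA (brow i) (bcol i)) brow_bcol mul1mx.
rewrite (mulmxA (brow j)) brow_bcol0 ?mul0mx ?mulmx0 ?subr0 //.
by apply: contraTneq ltij => ->; rewrite ltnn.
Qed.

Lemma ann_mul_upper m k (v : 'M_(k, n)) (i j : 'I_q) (Z : 'M_(p i, p j)) :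
  (i < j)%N -> (v <= ann C m.+1)%MS -> (v *m (bcol i *m Z *m brow j) <= ann C m)%MS.
Proof.
move=> ltij /sub_annS vP; rewrite -(upper_mxcomm Z ltij).
by apply: vP; [apply: idemC | apply: upperC].
Qed.

(** Upper bound for the flag: [ann C m] lives on the last [m] blocks. Otherwise a matrix unit would
    move a nonzero entry from block [j] to block [j.+1] and land in the previous term of the chain,
    against induction. *)
Lemma ann_bcol0 m k (v : 'M_(k, n)) (j : 'I_q) :
  (v <= ann C m)%MS -> (j + m < q)%N -> v *m bcol j = 0.
Proof.
elim: m k v j => [|m IHm] k v j; first by rewrite submx0 => /eqP-> _; rewrite mul0mx.
move=> vm ltjq; have ltj1 : (j.+1 < q)%N.
  by apply: leq_trans ltjq; rewrite ltnS addnS ltnS leq_addr.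
pose j1 := Ordinal ltj1; have r0 : 'I_(p j1) by exists 0%N.
(* [delta_mx b r0] copies column [b] of block [j] to column [r0] of block [j1], so entry [(a, r0)]
   of the result is entry [(a, b)] of [v *m bcol j]. *)
apply/matrixP => a b; have /= := IHm _ _ j1 (ann_mul_upper (delta_mx b r0) (ltnSn j) vm).
rewrite !mulmxA -[_ *m brow j1 *m bcol j1]mulmxA brow_bcol mulmx1.
rewrite addSnnS => /(_ ltjq)/matrixP/(_ a r0); set w := v *m bcol j.
rewrite [(w *m _) a r0]mxE (bigD1 b) //= [delta_mx _ _ b r0]mxE !eqxx mulr1.
rewrite big1 ?addr0 => [-> | c neqcb]; first by rewrite !mxE.
by rewrite [delta_mx _ _ c r0]mxE (negbTE neqcb) mulr0.
Qed.

(** Lower bound for the flag. Block row 0 lies in [ann C q], which is everything; each unit row of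
    the next block is a unit row of the current one times an upper matrix unit, which costs one step
    of the chain. *)
Lemma brow_ann (i : 'I_q) : satisfies_D q C -> (brow i <= ann C (q - i))%MS.
Proof.
move=> /satisfies_DE DC; case: i => i ltiq /=.
elim: i ltiq => [|i IHi] ltiq; first by rewrite subn0 (submx_trans (submx1 _)).
have lti := ltnW ltiq; have r0 : 'I_(p (Ordinal lti)) by exists 0%N.
apply/row_subP => r.
have := IHi lti; rewrite -subnSK // => /ann_mul_upper.
move=> /(_ _ (Ordinal ltiq) (delta_mx r0 r) (ltnSn i)).
rewrite !mulmxA brow_bcol mul1mx => /(submx_trans _); apply.
apply: (@submx_trans _ _ _ _ _ _ (row r0 (delta_mx r0 r *m brow (Ordinal ltiq)))).
  by rewrite row_mul rowE mul_delta_mx -rowE.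
exact: row_sub.
Qed.

Hypothesis hC : is_subalgebra C.
Hypothesis DC : satisfies_D q C.

(** Block row [i] stays in [ann C (q - i)] after multiplication by [M], hence vanishes on the blocks
    before [i]. *)
Lemma D_btrig M : M \in C -> btrig M.
Proof.
move=> CM i j ltji; rewrite mxblkE.
apply: (@ann_bcol0 (q - i)); first exact/ann_stable/brow_ann.
by rewrite -[X in (_ < X)%N](subnKC (ltnW (ltn_ord i))) ltn_add2r.
Qed.

(** A commutator takes block row [i] one step further down, to rows that vanish on block [i] too. *)
Lemma D_mxcomm_diag M N i : M \in C -> N \in C -> blk (mxcomm M N) i i = 0.
Proof.
move=> CM CN; rewrite mxblkE; apply: (@ann_bcol0 (q - i.+1)).
  have := brow_ann i DC; rewrite -subnSK // => /sub_annS; exact.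
by rewrite -addSn subnKC.
Qed.

End UpperBlocks.

End Fixed.

End Blocks.

(** * Bases adapted to a decreasing flag of row spaces *)

Section FlagBasis.

Variables (K : fieldType) (n q : nat) (F : nat -> 'M[K]_n).
Hypothesis F0 : (1%:M <= F 0)%MS.
Hypothesis Fq : F q = 0.
Hypothesis F_sub : forall i, (i < q)%N -> (F i.+1 <= F i)%MS.
Hypothesis F_strict : forall i, (i < q)%N -> ~~ (F i <= F i.+1)%MS.

Let p (i : 'I_q) := \rank (F i :\: F i.+1)%MS.

Lemma rank_flag : n = (\sum_i p i)%N.
Proof.
suff rkF m : (m <= q)%N ->
    n = (\sum_(i < m) \rank (F i :\: F i.+1)%MS + \rank (F m))%N.
  by rewrite [LHS](rkF q) // Fq mxrank0 addn0.
elim: m => [_ | m IHm ltmq].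
  by apply/esym/eqP; rewrite big_ord0 add0n -/(row_full _) -sub1mx.
rewrite [LHS]IHm 1?ltnW // big_ord_recr /= -addnA; congr (_ + _)%N.
by rewrite -(mxrank_cap_compl _ (F m.+1)) (capmx_idPr (F_sub ltmq)) addnC.
Qed.

Lemma flag_step_gt0 i : (0 < p i)%N.
Proof.
rewrite lt0n; apply: contraNneq (F_strict (ltn_ord i)) => p0.
apply/capmx_idPl/eqmxP; rewrite -(geq_leqif (mxrank_leqif_eq (capmxSl _ _))).
by rewrite -(mxrank_cap_compl (F i) (F i.+1)) [X in (_ + X)%N]p0 addn0.
Qed.

Let en := rank_flag.

Let R (i : 'I_q) : 'M[K]_(p i, n) := row_base (F i :\: F i.+1)%MS.

(** The blocks [R i] stacked vertically. As [R i] is a basis of a complement of [F i.+1] in [F i],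
    the blocks from [k] on span [F k]. *)
Definition flag_basis : 'M[K]_n := \sum_i bcol K en i *m R i.

Local Notation X := flag_basis.

Lemma brow_flag_basis i : brow K en i *m X = R i.
Proof.
rewrite mulmx_sumr (bigD1 i) //= mulmxA brow_bcol mul1mx big1 ?addr0 // => j.
by rewrite eq_sym => neqij; rewrite mulmxA brow_bcol0 ?mul0mx.
Qed.

Lemma flag_decomp (i : 'I_q) : (F i <= F i.+1 + R i)%MS.
Proof.
rewrite -(addsmx_diff_cap_eq (F i) (F i.+1)) addsmxC.
by rewrite addsmxS ?capmxSr // eq_row_base.
Qed.

Lemma flag_basis_unit : X \in unitmx.
Proof.
rewrite -row_full_unit -sub1mx; apply: submx_trans F0 _.
suff FX m : (m <= q)%N -> (F (q - m) <= X)%MS by rewrite -(subnn q) FX.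
elim: m => [_ | m IHm ltmq]; first by rewrite subn0 Fq sub0mx.
have ltq : (q - m.+1 < q)%N by rewrite ltn_subrL (leq_trans _ ltmq).
apply: submx_trans (flag_decomp (Ordinal ltq)) _.
rewrite addsmx_sub subnSK //= IHm 1?ltnW //=.
by rewrite -brow_flag_basis submxMl.
Qed.

(** Right multiplication by [invmx X] takes coordinates in the rows of [X], and [F k] involves only
    the blocks from [k] on. *)
Lemma flag_basis_bcol0 k (j : 'I_q) :
  (j < k)%N -> (k <= q)%N -> F k *m invmx X *m bcol K en j = 0.
Proof.
move=> ltjk lekq; rewrite -(subKn lekq).
have : (q - (q - k) > j)%N by rewrite subKn.
elim: (q - k)%N (leq_subr k q) => [|m IHm] ltmq ltj.
  by rewrite subn0 Fq !mul0mx.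
have ltq : (q - m.+1 < q)%N by rewrite ltn_subrL (leq_trans _ ltmq).
have /sub_addsmxP[[U V] /= ->] := flag_decomp (Ordinal ltq).
rewrite subnSK // -brow_flag_basis !mulmxDl.
rewrite -!mulmxA (mulmxA X) mulmxV ?flag_basis_unit // mul1mx.
rewrite brow_bcol0 ?mulmx0 ?addr0; last first.
  by apply: contraTneq ltj => <-; rewrite ltnn.
have ltj' := leq_trans ltj (leq_sub2l q (leqnSn m)).
by rewrite (mulmxA (F _)) (IHm (ltnW ltmq) ltj') mulmx0.
Qed.

(** The block is the [j]-th part of the coordinates of [R i *m M], whose rows lie in [F k]. The case
    [k = i] gives triangularity, [k = i.+1] also kills the diagonal block. *)
Lemma mxblk_flag_basis (i j : 'I_q) k (M : 'M[K]_n) :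
  (F i *m M <= F k)%MS -> (j < k)%N -> (k <= q)%N ->
  mxblk en (X *m M *m invmx X) i j = 0.
Proof.
move=> FM ltjk lekq; rewrite mxblkE !mulmxA brow_flag_basis -!mulmxA (mulmxA M).
have: (R i *m M <= F k)%MS.
  by apply: submx_trans FM; rewrite submxMr // eq_row_base diffmxSl.
case/submxP=> Y; rewrite !mulmxA => ->.
by rewrite -(mulmxA Y) -(mulmxA Y) flag_basis_bcol0 ?mulmx0.
Qed.

End FlagBasis.

(** * Conjugation, and extension to maximal commutative subalgebras *)

Section Conjugation.

Variables (K : fieldType) (n : nat).
Implicit Types (X M N : 'M[K]_n) (A B C : {vspace 'M[K]_n}).

Definition conjv X A : {vspace 'M[K]_n} :=
  (linfun (mulmxr X \o mulmx (invmx X)) @: A)%VS.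

Lemma memv_conjv X A M :
  M \in conjv X A <-> exists2 N, N \in A & M = invmx X *m N *m X.
Proof.
by split=> [/memv_imgP[N AN ->] | [N AN ->]];
  [exists N; rewrite ?lfunE | apply/memv_imgP; exists N; rewrite ?lfunE].
Qed.

Lemma conjv_sub X A B : (A <= B)%VS -> (conjv X A <= conjv X B)%VS.
Proof. exact: limgS. Qed.

Lemma conjvK X A : X \in unitmx -> conjv (invmx X) (conjv X A) = A.
Proof.
move=> uX; apply/vspaceP => M; apply/idP/idP => [|AM].
  case/memv_conjv=> _ /memv_conjv[N AN ->] ->.
  by rewrite invmxK !mulmxA mulmxV // mul1mx mulmxK.
apply/memv_conjv; exists (invmx X *m M *m X); first by apply/memv_conjv; exists M.
by rewrite invmxK !mulmxA mulmxV // mul1mx mulmxK.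
Qed.

Lemma conjugatedP A B :
  conjugated A B <-> exists2 X, X \in unitmx & B = conjv X A.
Proof.
split=> -[X uX BA]; exists X => //; last by move=> M; rewrite BA memv_conjv.
by apply/vspaceP => M; apply/idP/idP => [/BA/memv_conjv | /memv_conjv/BA].
Qed.

Lemma mulmx_conj X M N : X \in unitmx ->
  (invmx X *m M *m X) *m (invmx X *m N *m X) = invmx X *m (M *m N) *m X.
Proof. by move=> uX; rewrite !mulmxA mulmxK. Qed.

Lemma conjv_subalgebra X A :
  X \in unitmx -> is_subalgebra A -> is_subalgebra (conjv X A).
Proof.
move=> uX [A1 AM]; split.
  by apply/memv_conjv; exists 1%:M; rewrite ?mulmx1 ?mulVmx.
move=> _ _ /memv_conjv[M AM' ->] /memv_conjv[N AN ->].
by apply/memv_conjv; exists (M *m N); rewrite ?mulmx_conj ?AM.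
Qed.

Lemma satisfies_D_conjv X A m :
  X \in unitmx -> satisfies_D m A -> satisfies_D m (conjv X A).
Proof.
move=> uX DA x y cx cy.
pose back (z : 'I_m -> 'M[K]_n) i := X *m z i *m invmx X.
have backA z : (forall i, z i \in conjv X A) -> forall i, back z i \in A.
  move=> cz i; have /memv_conjv[N AN ziN] := cz i.
  by rewrite /back ziN !mulmxA mulmxV // mul1mx mulmxK.
have backK z i : z i = invmx X *m back z i *m X.
  by rewrite /back !mulmxA mulVmx // mul1mx mulmxKV.
pose cj M := invmx X *m M *m X.
have cjM : {morph cj : M N / M * N} by move=> M N; rewrite -mulmxE mulmx_conj.
have cj1 : cj 1 = 1 by rewrite /cj mulmx1 mulVmx.
rewrite (eq_bigr (fun i => cj (mxcomm (back x i) (back y i)))) => [|i _].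
  by rewrite -(big_morph cj cjM cj1) DA /cj ?mulmx0 ?mul0mx //; apply: backA.
by rewrite (backK x) (backK y) /cj /mxcomm !mulmx_conj // -mulmxBl -mulmxBr.
Qed.

Lemma is_D_conjv X A m : X \in unitmx -> is_D m A -> is_D m (conjv X A).
Proof.
move=> uX [DA nDA]; split; first exact: satisfies_D_conjv.
by move=> DcA; apply: nDA; rewrite -(conjvK A uX); apply: satisfies_D_conjv;
  rewrite ?unitmx_inv.
Qed.

Lemma maximal_D_conjv X A m :
  X \in unitmx -> maximal_D m A -> maximal_D m (conjv X A).
Proof.
move=> uX [hA DA maxA]; have uX' : invmx X \in unitmx by rewrite unitmx_inv.
split; [exact: conjv_subalgebra | exact: is_D_conjv | move=> C hC DC sAC].
(* A competitor [C] is conjugated back, where the maximality of [A] applies. *)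
rewrite -[LHS](conjvK _ uX') invmxK; congr (conjv _ _); apply: maxA.
- exact: conjv_subalgebra.
- exact: is_D_conjv.
- by rewrite -[X in (X <= _)%VS](conjvK A uX) conjv_sub.
Qed.

Lemma satisfies_D_sub A B m : (A <= B)%VS -> satisfies_D m B -> satisfies_D m A.
Proof. by move=> /subvP sAB DB x y Ax Ay; apply: DB => i; apply: sAB. Qed.

(** Induction on the codimension: a non-maximal [A] has a strictly larger commutative overalgebra.
    Maximality is decided classically. *)
Lemma ex_maximal_commutative A : is_subalgebra A -> is_commutative A ->
  exists2 B, maximal_commutative B & (A <= B)%VS.
Proof.
have [k] := ubnP (\dim {:'M[K]_n} - \dim A)%N.
elim: k A => // k IHk A ltk hA cA.
have [maxA | nmaxA] := classic (maximal_commutative A); first by exists A.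
have [B [hB cB sAB neqBA]] : exists B,
    [/\ is_subalgebra B, is_commutative B, (A <= B)%VS & B <> A].
  apply: NNPP => noB; apply: nmaxA; split=> // B hB cB sAB.
  by apply: NNPP => neqBA; apply: noB; exists B.
have ltdim : (\dim A < \dim B)%N.
  rewrite ltn_neqAle dimvS // andbT; apply: contra_notN neqBA => /eqP dimAB.
  by apply/eqP; rewrite eq_sym eqEdim sAB dimAB leqnn.
have /IHk/(_ hB cB)[E maxE sBE] : (\dim {:'M[K]_n} - \dim B < k)%N.
  apply: leq_trans (_ : _ <= \dim {:'M[K]_n} - \dim A)%N _; last by rewrite -ltnS.
  by rewrite ltn_sub2l // (leq_trans ltdim) // dimvS ?subvf.
by exists E => //; apply: subv_trans sBE.
Qed.

End Conjugation.

(** * Block triangular algebras with prescribed diagonal blocks *)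

Section BlockAlgebras.

Variables (K : fieldType) (n q : nat) (p : 'I_q -> nat).
Variable en : n = (\sum_i p i)%N.
Implicit Types (M N : 'M[K]_n) (A B C : {vspace 'M[K]_n}).

Local Notation blk := (@mxblk K n q p en).
Local Notation brow := (brow K en).
Local Notation bcol := (bcol K en).

Definition blkf i j : 'Hom('M[K]_n, 'M[K]_(p i, p j)) :=
  linfun (mulmxr (bcol j) \o mulmx (brow i)).

Lemma blkfE i j M : blkf i j M = blk M i j.
Proof. by rewrite lfunE mxblkE. Qed.

(** Linear preimages and kernels make this a subspace by construction. *)
Definition block_algebra (D : forall i, {vspace 'M[K]_(p i)}) :=
  ((\bigcap_i (blkf i i @^-1: D i)) :&:
   \bigcap_(ij : 'I_q * 'I_q | (ij.2 < ij.1)%N) lker (blkf ij.1 ij.2))%VS.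

Lemma mem_block_algebra D M :
  M \in block_algebra D <-> (forall i, blk M i i \in D i) /\ btrig en M.
Proof.
rewrite memv_cap; split=> [/andP[] | [MD tM]].
  rewrite !memvE => /subv_bigcapP MD /subv_bigcapP tM; split=> [i | i j ltji].
    by have := MD i isT; rewrite -memvE -memv_preim blkfE.
  by have := tM (i, j) ltji; rewrite -memvE memv_ker blkfE => /eqP.
rewrite !memvE; apply/andP; split.
  by apply/subv_bigcapP => i _; rewrite -memvE -memv_preim blkfE ?MD.
by apply/subv_bigcapP => -[i j] ltji; rewrite -memvE memv_ker blkfE tM.
Qed.

Definition diag_blk C i := (blkf i i @: C)%VS.

Lemma mem_diag_blk C i (N : 'M_(p i)) :
  N \in diag_blk C i <-> exists2 M, M \in C & N = blk M i i.
Proof.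
split=> [/memv_imgP[M CM ->] | [M CM ->]]; first by exists M; rewrite ?blkfE.
by rewrite -blkfE memv_img.
Qed.

Lemma diag_blk_subalgebra C i :
  is_subalgebra C -> {in C, forall M, btrig en M} -> is_subalgebra (diag_blk C i).
Proof.
move=> [C1 CM] tC; split; first by apply/mem_diag_blk; exists 1%:M; rewrite ?mxblk1.
move=> _ _ /mem_diag_blk[M CM' ->] /mem_diag_blk[N CN ->].
by apply/mem_diag_blk; exists (M *m N); rewrite ?CM ?mxblkM_diag //; apply: tC.
Qed.

Lemma diag_blk_commutative C i : {in C, forall M, btrig en M} ->
  {in C &, forall M N, blk (mxcomm M N) i i = 0} -> is_commutative (diag_blk C i).
Proof.
move=> tC comm0 _ _ /mem_diag_blk[M CM ->] /mem_diag_blk[N CN ->].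
rewrite -!mxblkM_diag; try exact: tC.
by apply/eqP; rewrite -subr_eq0 -mxblkB; apply/eqP/comm0.
Qed.

Section DiagonalBlocks.

Variables (A : {vspace 'M[K]_n}) (D : forall i, {vspace 'M[K]_(p i)}).
Hypothesis AD : of_type_with_diagonal_blocks en A D.
Hypothesis cD : forall i, is_commutative (D i).

Lemma of_type_mxcomm0 : {in A &, forall M N, forall i j : 'I_q,
  (j <= i)%N -> blk (mxcomm M N) i j = 0}.
Proof.
have [_ _ memA] := AD; move=> M N /memA[DM tM] /memA[DN tN] i j.
rewrite leq_eqVlt => /predU1P[/val_inj-> | ltji]; last first.
  by apply: btrigB => //; apply: btrigM.
by rewrite mxblkB !mxblkM_diag // (cD _ (DN _)) ?subrr ?DM ?DN.
Qed.

Lemma of_type_subalgebra : is_subalgebra A.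
Proof.
have [_ hD memA] := AD; split.
  apply/memA; split=> [i|]; last exact: btrig1.
  by rewrite mxblk1; case: (hD i).
move=> M N /memA[DM tM] /memA[DN tN]; apply/memA; split=> [i|]; last exact: btrigM.
by rewrite mxblkM_diag //; case: (hD i) => _ ->; rewrite ?DM ?DN.
Qed.

Lemma of_type_idem k : bcol k *m brow k \in A.
Proof.
have [_ hD memA] := AD; apply/memA; split=> [i | i j ltji].
  have [-> | neqik] := eqVneq i k.
    by rewrite mxblkE mulmxA brow_bcol mul1mx brow_bcol; case: (hD k).
  by rewrite mxblkE mulmxA brow_bcol0 // !mul0mx mem0v.
have [eqik | neqik] := eqVneq i k; last by rewrite mxblkE mulmxA brow_bcol0 // !mul0mx.
rewrite mxblkE -!mulmxA (brow_bcol0 K en (j := j)) ?mulmx0 // -eqik.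
by apply: contraTneq ltji => ->; rewrite ltnn.
Qed.

Lemma of_type_upper (k l : 'I_q) (Z : 'M_(p k, p l)) :
  (k < l)%N -> bcol k *m Z *m brow l \in A.
Proof.
move=> ltkl; have [_ hD memA] := AD.
have blk0 (i j : 'I_q) : (j <= i)%N -> blk (bcol k *m Z *m brow l) i j = 0.
  move=> leji; have [eqik | neqik] := eqVneq i k; last first.
    by rewrite mxblkE !mulmxA brow_bcol0 // !mul0mx.
  rewrite mxblkE -!mulmxA brow_bcol0 ?mulmx0 //.
  by apply: contraTneq ltkl => ->; rewrite -leqNgt -eqik.
by apply/memA; split=> [i | i j ltji]; rewrite blk0 ?mem0v // ltnW.
Qed.

End DiagonalBlocks.

Lemma of_type_maximal_D A (D : forall i, {vspace 'M[K]_(p i)}) : (1 < q)%N ->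
  of_type_with_diagonal_blocks en A D ->
  (forall i, maximal_commutative (D i)) -> maximal_D q A.
Proof.
move=> q_gt1 AD maxD; have [p_gt0 hD memA] := AD.
have cD i : is_commutative (D i) by case: (maxD i).
have idemA := of_type_idem AD; have upperA := of_type_upper AD.
split=> [||C hC [DC _] sAC].
- exact: of_type_subalgebra AD.
- split; first exact: strict_satisfies_D (of_type_mxcomm0 AD cD).
  (* Under D_(q-1) the full space would be [ann A q.-1], which vanishes on block 0; but that block
     is nonempty. *)
  pose i0 := Ordinal (ltnW q_gt1).
  move/satisfies_DE => full; have := ann_bcol0 p_gt0 idemA upperA (j := i0) full.
  rewrite /= add0n ltn_predL ltnW // mul1mx => /(_ isT) bcol0.
  have := brow_bcol K en i0; rewrite bcol0 mulmx0 => /matrixP.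
  have r0 : 'I_(p i0) by exists 0%N.
  by move=> /(_ r0 r0)/eqP; rewrite !mxE eqxx eq_sym oner_eq0.
(* [C] inherits from [A] what is needed to compute its flag. *)
have idemC i : bcol i *m brow i \in C := subvP sAC _ (idemA i).
have upperC (i j : 'I_q) (Z : 'M_(p i, p j)) :
  (i < j)%N -> bcol i *m Z *m brow j \in C.
  by move=> ltij; apply: (subvP sAC); apply: upperA.
have tC : {in C, forall M, btrig en M} := D_btrig p_gt0 idemC upperC hC DC.
apply/eqP; rewrite eqEsubv sAC andbT; apply/subvP => M CM; apply/memA.
split=> [i|]; last exact: tC.
(* The [i]-th diagonal block of [C] is a commutative subalgebra containing [D i], hence equal to
   it. *)
have [_ _ maxDi] := maxD i; rewrite -(maxDi (diag_blk C i)).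
- by apply/mem_diag_blk; exists M.
- exact: diag_blk_subalgebra.
- by apply: diag_blk_commutative => // x y Cx Cy; apply: D_mxcomm_diag Cx Cy.
apply/subvP => N DN; apply/mem_diag_blk.
(* [N] placed in block [(i, i)], with zeros elsewhere, already lies in [A]. *)
exists (bcol i *m N *m brow i); last first.
  by rewrite mxblkE !mulmxA brow_bcol mul1mx -mulmxA brow_bcol mulmx1.
apply/(subvP sAC)/memA; split=> [k | k l ltlk].
  have [-> | neqki] := eqVneq k i.
    by rewrite mxblkE !mulmxA brow_bcol mul1mx -mulmxA brow_bcol mulmx1.
  by rewrite mxblkE !mulmxA brow_bcol0 // !mul0mx mem0v.
have [eqki | neqki] := eqVneq k i; last by rewrite mxblkE !mulmxA brow_bcol0 // !mul0mx.
rewrite mxblkE -!mulmxA (brow_bcol0 K en (j := l)) ?mulmx0 // -eqki.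
by apply: contraTneq ltlk => ->; rewrite ltnn.
Qed.

End BlockAlgebras.

(** * The two directions of the characterization *)

Lemma maximal_D_of_type (K : fieldType) (n q : nat) (A : {vspace 'M[K]_n}) :
  (1 < q)%N -> maximal_D q A ->
  exists (p : 'I_q -> nat) (B : {vspace 'M[K]_n}),
    of_type_with_max_comm_dbs p B /\ conjugated A B.
Proof.
move=> q_gt1 [hA [DA nDA] maxA].
(* The chain is reversed, so that smaller spaces correspond to later blocks. *)
pose F i := ann A (q - i).
have F0 : (1%:M <= F 0)%MS by rewrite /F subn0; apply/satisfies_DE.
have Fq : F q = 0 by rewrite /F subnn.
have Fsub i : (i < q)%N -> (F i.+1 <= F i)%MS by move=> _; apply/ann_sub/leq_sub2l.
have Fstrict i : (i < q)%N -> ~~ (F i <= F i.+1)%MS.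
  (* If the chain stalled here, it would already be full at this index, which is at most [q.-1]. *)
  move=> ltiq; apply/negP; rewrite /F -subnSK // => stat; apply/nDA/satisfies_DE.
  apply: submx_trans F0 (submx_trans (ann_const _ stat) _).
  by apply: ann_sub; rewrite subnS -!subn1 leq_sub2r ?leq_subr.
pose en := rank_flag F0 Fq Fsub; pose X := flag_basis F0 Fq Fsub.
have uX : X \in unitmx by apply: flag_basis_unit.
have uX' : invmx X \in unitmx by rewrite unitmx_inv.
(* Its elements are [X *m M *m invmx X], that is, [A] written in the adapted basis. *)
pose A' := conjv (invmx X) A.
have hA' : is_subalgebra A' by apply: conjv_subalgebra.
have tA' : {in A', forall M, btrig en M}.
  move=> _ /memv_conjv[M AM ->] i j ltji; rewrite invmxK.
  by apply: (mxblk_flag_basis F0 Fq Fsub (k := i)); rewrite ?ann_stable // ltnW.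
have cA' i : {in A' &, forall M N, mxblk en (mxcomm M N) i i = 0}.
  move=> _ _ /memv_conjv[M AM ->] /memv_conjv[N AN ->].
  rewrite /mxcomm !mulmx_conj // -mulmxBl -mulmxBr invmxK.
  apply: (mxblk_flag_basis F0 Fq Fsub (k := i.+1)) => //.
  by have := submx_refl (F i); rewrite {2}/F -subnSK // => /sub_annS; apply.
have /fin_all_exists2 exD i := ex_maximal_commutative
  (diag_blk_subalgebra i hA' tA') (diag_blk_commutative tA' (@cA' i)).
have [D maxD sAD] := exD.
pose B := block_algebra en D.
have BD : of_type_with_diagonal_blocks en B D.
  split=> [i | i | M]; [exact: flag_step_gt0 | by case: (maxD i) |].
  exact: mem_block_algebra.
have hB := of_type_subalgebra BD.
have [_ [DB _] _] := of_type_maximal_D q_gt1 BD maxD.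
have sA'B : (A' <= B)%VS.
  apply/subvP => M AM; apply/mem_block_algebra; split=> [i|]; last exact: tA'.
  by apply/(subvP (sAD i))/mem_diag_blk; exists M.
have sAB : (A <= conjv X B)%VS.
  by rewrite -(conjvK A uX') invmxK conjv_sub.
have eqBA : conjv X B = A.
  apply: maxA => //; first exact: conjv_subalgebra.
  (* Maximality only concerns algebras that are not D_(q-1); [conjv X B] is one because it contains
     [A]. *)
  split; first exact: satisfies_D_conjv.
  by move/(satisfies_D_sub sAB).
exists (fun i : 'I_q => \rank (F i :\: F i.+1)%MS), B; split; first by split=> //; exists en, D.
by apply/conjugatedP; exists (invmx X); rewrite -?eqBA ?conjvK.
Qed.

Theorem corollary4p4 (K : fieldType) (n q : nat) (hn : (1 <= n)%N)
    (hq : (2 <= q)%N) (A : {vspace 'M[K]_n}) (hA : is_subalgebra A) :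
  maximal_D q A <->
  exists (p : 'I_q -> nat) (B : {vspace 'M[K]_n}),
    of_type_with_max_comm_dbs p B /\ conjugated A B.
Proof.
split=> [|[p [B [[_ [en [D [BD maxD]]]] /conjugatedP[X uX defB]]]]].
  exact: maximal_D_of_type.
(* [A] is recovered from [B] by the inverse conjugation, which preserves maximality. *)
rewrite -(conjvK A uX) -defB; apply: maximal_D_conjv; first by rewrite unitmx_inv.
exact: of_type_maximal_D BD maxD.
Qed.
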